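(* Let $\rho_0,\rho_1$ be states on a finite-dimensional complex Hilbert space. For $N\ge1$ let $R=R_N$ be the minimal average error probability for deciding between $\rho_0$ and $\rho_1$ (each with prior probability $1/2$) by a joint measurement of $N$ identical copies of the state. Let $F(\rho_0,\rho_1)=\operatorname{tr}\sqrt{\sqrt{\rho_0}\,\rho_1\sqrt{\rho_0}}$ be the fidelity. Then for every $N\ge1$ $$\frac12\left(1-\sqrt{1-[F(\rho_0,\rho_1)]^{2N}}\right)\le R_N\le\frac12[F(\rho_0,\rho_1)]^N.$$ Asymptotically, $$2\log F(\rho_0,\rho_1)\le\liminf_{N\to\infty}\frac1N\log R_N\quad\text{and}\quad\limsup_{N\to\infty}\frac1N\log R_N\le\log F(\rho_0,\rho_1)$$ (with $\log0=-\infty$). If moreover $\rho_0$ is pure, $\rho_0=|\psi_0\rangle\langle\psi_0|$ with $\psi_0$ a unit vector, then for every $N\ge1$ the tighter upper bound $$R_N\le\frac12[F(\rho_0,\rho_1)]^{2N}=\frac12\langle\psi_0|\rho_1|\psi_0\rangle^N$$ holds.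
   Context: A state on a finite-dimensional complex Hilbert space $H$ is a positive semidefinite operator of trace $1$; it is pure if it has rank one. For a positive semidefinite $X$, $\sqrt X$ is the unique positive semidefinite Hermitian $Y$ with $Y^2=X$. A measurement on a Hilbert space is a finite family $\{M_i\}$ of positive semidefinite operators summing to the identity; when applied to a state $\rho$, outcome $i$ occurs with probability $\operatorname{tr}(M_i\rho)$. A joint measurement of $N$ copies is a measurement on $H^{\otimes N}$ applied to $\rho_0^{\otimes N}$ or $\rho_1^{\otimes N}$. After observing the outcome, a decision rule chooses $\rho_0$ or $\rho_1$. The average error probability is $\frac12 \Pr(\text{choose }\rho_1\mid\rho_0)+\frac12\Pr(\text{choose }\rho_0\mid\rho_1)$, and $R_N$ is its minimum over all joint measurements and decision rules. By the Holevo–Helstrom theorem, $R_N=\frac12\left(1-\frac12\|\rho_0^{\otimes N}-\rho_1^{\otimes N}\|_1\right)$, where $\|A\|_1$ is the sum of absolute values of the eigenvalues of the Hermitian operator $A$. *)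

(* Defs.v *)
From HB Require Import structures.
From mathcomp Require Import all_boot all_order all_algebra.
From mathcomp Require Import complex.
From mathcomp Require mxtens.
From mathcomp Require Import all_classical all_reals all_analysis.

Set Implicit Arguments.
Unset Strict Implicit.
Unset Printing Implicit Defensive.

Import Order.TTheory GRing.Theory Num.Theory.

Local Open Scope ring_scope.
Local Open Scope classical_set_scope.
Local Open Scope sesquilinear_scope.
Local Open Scope complex_scope.

(* The Hilbert space is C^d with C = R[i]; [A ^t*] is the conjugate transpose.
   The space of N copies is C^(d ^ N), with [mxtens.ntensmx A N] the
   N-fold Kronecker power of [A]. *)

Section Quantum.
Variable R : realType.

(* The order of [R[i]] makes [0 <= z] mean that [z] is real and nonnegative. *)
Definition psdmx n (A : 'M[R[i]]_n) : Prop :=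
  A \is hermsymmx /\ forall v : 'cV[R[i]]_n, 0 <= (v ^t* *m A *m v) 0 0.

(* The unique positive semidefinite square root; the default value 0 is only
   reached when [A] has none, i.e. when [A] is not positive semidefinite. *)
Definition sqrtmx n (A : 'M[R[i]]_n) : 'M[R[i]]_n :=
  xget 0 [set Y | psdmx Y /\ Y *m Y = A].

Definition is_state n (rho : 'M[R[i]]_n) : Prop := psdmx rho /\ \tr rho = 1.

Definition is_pure n (rho : 'M[R[i]]_n) : Prop :=
  is_state rho /\ \rank rho = 1%N.

(* The trace is a nonnegative real for states, so [Re] loses nothing. *)
Definition fidelity n (rho0 rho1 : 'M[R[i]]_n) : R :=
  complex.Re (\tr (sqrtmx (sqrtmx rho0 *m rho1 *m sqrtmx rho0))).

Definition is_measurement n (I : finType) (M : I -> 'M[R[i]]_n) : Prop :=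
  (forall i, psdmx (M i)) /\ \sum_i M i = 1%:M.

Definition outcome_prob n (I : finType) (M : I -> 'M[R[i]]_n)
    (rho : 'M[R[i]]_n) (i : I) : R :=
  complex.Re (\tr (M i *m rho)).

(* [rule i = false] chooses the first state on outcome [i], [rule i = true]
   the second one. *)
Definition average_error n (rho0 rho1 : 'M[R[i]]_n) (I : finType)
    (M : I -> 'M[R[i]]_n) (rule : I -> bool) : R :=
  2^-1 * (\sum_(i | rule i) outcome_prob M rho0 i) +
  2^-1 * (\sum_(i | ~~ rule i) outcome_prob M rho1 i).

Definition joint_errors d (rho0 rho1 : 'M[R[i]]_d) (N : nat) : set R :=
  [set e | exists (I : finType) (M : I -> 'M[R[i]]_(d ^ N)) (rule : I -> bool),
     is_measurement M /\
     e = average_error (mxtens.ntensmx rho0 N) (mxtens.ntensmx rho1 N) M rule].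

(* The least element of the set of achievable errors, which exists by the
   Holevo-Helstrom theorem (0 is the default value of [xget]). *)
Definition min_error d (rho0 rho1 : 'M[R[i]]_d) (N : nat) : R :=
  xget 0 [set e | joint_errors rho0 rho1 N e /\
                  lbound (joint_errors rho0 rho1 N) e].

End Quantum.

(* Main.v *)
Require Import Defs.
From mathcomp Require Import all_boot all_order all_algebra.
From mathcomp Require Import complex.
From mathcomp Require mxtens.
From mathcomp Require Import all_classical all_reals all_analysis.
From mathcomp Require Import ring lra.

(* Write S, T for the square roots of the two states A, B (on N copies), and
   call P a test when 0 <= P <= 1; a measurement with a decision rule amounts
   to a test, with error (tr (P A) + tr ((1 - P) B)) / 2, and the projection
   onto the negative eigenspace of A - B is optimal.

   Upper bound: projecting onto the negative eigenspace of S - T gives error at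
   most tr (S T) / 2 (Powers-Stormer), and |tr X| <= tr sqrt (X X^* ) with
   X = S T bounds this by F / 2.  The inequality behind it,
   |u^* (S - T) u| <= u^* (S + T) u for eigenvectors u of S - T, also shows
   that positive square roots are unique.

   Lower bound: with the polar decomposition F = tr (S T W), inserting
   1 = P + (1 - P) between S and T and applying Cauchy-Schwarz twice gives
   F <= sqrt(p q) + sqrt((1 - p) (1 - q)) for p = tr (P A), q = tr (P B),
   hence F^2 + (p - q)^2 <= 1.

   Square roots are compatible with Kronecker powers, so the fidelity of N
   copies is F^N.  A pure state A is a projection with A B A = tr (A B) A, so
   F^2 = tr (A B), which is twice the error of the test 1 - A. *)

Set Implicit Arguments.
Unset Strict Implicit.

Import Order.TTheory GRing.Theory Num.Theory.

Local Open Scope ring_scope.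
Local Open Scope sesquilinear_scope.
Local Open Scope complex_scope.

(* At [C = R[i]] this is convertible to [psdmx]. Over an abstract field
   unification never unfolds the arithmetic of [R[i]]. *)
Definition psd (C : numClosedFieldType) n (A : 'M[C]_n) : Prop :=
  A \is hermsymmx /\ forall v : 'cV[C]_n, 0 <= (v ^t* *m A *m v) 0 0.

(** * Positive semidefinite matrices: spectral form and square roots *)

Section PositiveMatrices.
Context {C : numClosedFieldType}.

Lemma adjmxM m n p (A : 'M[C]_(m, n)) (B : 'M[C]_(n, p)) :
  (A *m B) ^t* = B ^t* *m A ^t*.
Proof. by rewrite trmx_mul map_mxM. Qed.

Lemma adjmxD m n (A B : 'M[C]_(m, n)) : (A + B) ^t* = A ^t* + B ^t*.
Proof. by rewrite linearD /= map_mxD. Qed.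

Lemma adjmxB m n (A B : 'M[C]_(m, n)) : (A - B) ^t* = A ^t* - B ^t*.
Proof. by rewrite linearB /= map_mxB. Qed.

Lemma adjmx1 n : (1%:M : 'M[C]_n) ^t* = 1%:M.
Proof. by rewrite tr_scalar_mx map_scalar_mx /= conjC1. Qed.

Lemma hermsymmxE n (A : 'M[C]_n) : (A \is hermsymmx) = (A ^t* == A).
Proof. by rewrite is_hermitianmxE expr0 scale1r eq_sym. Qed.

Lemma adjmx_diag n (s : 'rV[C]_n) :
  (forall k, s 0 k \is Num.real) -> (diag_mx s) ^t* = diag_mx s.
Proof.
move=> s_real; apply/matrixP => i j; rewrite !mxE.
have [->|_] := eqVneq j i; rewrite ?mulr0n ?conjC0 // !mulr1n.
exact/CrealP/s_real.
Qed.

Lemma mulmx_ct_ge0 m (v : 'cV[C]_m) : 0 <= (v ^t* *m v) 0 0.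
Proof.
by rewrite mxE sumr_ge0 // => k _; rewrite !mxE mulrC mul_conjC_ge0.
Qed.

Lemma psd_ctmul m n (S : 'M[C]_(m, n)) : psd (S ^t* *m S).
Proof.
split; first by rewrite hermsymmxE adjmxM trmxCK.
by move=> v; rewrite mulmxA -adjmxM -mulmxA mulmx_ct_ge0.
Qed.

Lemma psd_adj {n} {A : 'M[C]_n} : psd A -> A ^t* = A.
Proof. by case; rewrite hermsymmxE => /eqP. Qed.

Lemma psd_conj m n (S : 'M[C]_(m, n)) (A : 'M[C]_m) :
  psd A -> psd (S ^t* *m A *m S).
Proof.
move=> psdA; split.
  by rewrite hermsymmxE !adjmxM trmxCK (psd_adj psdA) mulmxA.
by move=> v; rewrite !mulmxA -adjmxM -mulmxA; case: psdA => _; apply.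
Qed.

Lemma psdD n (A B : 'M[C]_n) : psd A -> psd B -> psd (A + B).
Proof.
move=> psdA psdB; split.
  by rewrite hermsymmxE adjmxD (psd_adj psdA) (psd_adj psdB).
move=> v; rewrite mulmxDr mulmxDl mxE addr_ge0 //.
  by case: psdA => _; apply.
by case: psdB => _; apply.
Qed.

Lemma psd0 n : psd (0 : 'M[C]_n).
Proof. by have := psd_ctmul (0 : 'M[C]_n); rewrite mulmx0. Qed.

Lemma psd_sum n (I : finType) (P : pred I) (M : I -> 'M[C]_n) :
  (forall i, psd (M i)) -> psd (\sum_(i | P i) M i).
Proof.
move=> psdM; apply: big_ind => [|A B|i _]; [exact: psd0|exact: psdD|].
exact: psdM.
Qed.

Lemma psdZ n (c : C) (A : 'M[C]_n) : 0 <= c -> psd A -> psd (c *: A).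
Proof.
move=> c_ge0 psdA; split.
  rewrite hermsymmxE linearZ /= map_mxZ (psd_adj psdA).
  by apply/eqP; congr (_ *: _); apply/CrealP/ger0_real.
by move=> v; rewrite -scalemxAr -scalemxAl mxE mulr_ge0 //; case: psdA => _; apply.
Qed.

Lemma psd_diag_ge0 {n} {A : 'M[C]_n} : psd A -> forall k, 0 <= A k k.
Proof.
case=> _ A_ge0 k; have := A_ge0 (delta_mx k 0).
suff -> : (delta_mx k 0 : 'cV[C]_n) ^t* *m A *m delta_mx k 0 = (A k k)%:M.
  by rewrite mxE mulr1n.
rewrite trmx_delta map_delta_mx -rowE -colE; apply/matrixP => i j.
by rewrite !ord1 !mxE mulr1n.
Qed.

Lemma psd_tr_ge0 n (A : 'M[C]_n) : psd A -> 0 <= \tr A.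
Proof. by move=> psdA; rewrite sumr_ge0 // => k _; apply: psd_diag_ge0. Qed.

Lemma spectral_decomp n (A : 'M[C]_n) : A ^t* = A ->
  exists (U : 'M[C]_n) (s : 'rV[C]_n),
    [/\ U *m U ^t* = 1%:M, U ^t* *m U = 1%:M, forall k, s 0 k \is Num.real &
        A = U ^t* *m diag_mx s *m U].
Proof.
move=> /eqP; rewrite -hermsymmxE => hA.
have uU := spectral_unitarymx A.
exists (spectralmx A), (spectral_diag A); split.
- exact/unitarymxP.
- by rewrite -(invmx_unitary uU) mulVmx // spectral_unit.
- by move=> k; apply/mxOverP/hermitian_spectral_diag_real.
by rewrite -(invmx_unitary uU); apply/orthomx_spectralP/hermitian_normalmx.
Qed.

Lemma conj_spectral n (U A : 'M[C]_n) (s : 'rV[C]_n) :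
  U *m U ^t* = 1%:M -> A = U ^t* *m diag_mx s *m U ->
  U *m A *m U ^t* = diag_mx s.
Proof. by move=> UU ->; rewrite !mulmxA UU mul1mx -mulmxA UU mulmx1. Qed.

Lemma psd_spectral_decomp n (A : 'M[C]_n) : psd A ->
  exists (U : 'M[C]_n) (s : 'rV[C]_n),
    [/\ U *m U ^t* = 1%:M, U ^t* *m U = 1%:M, forall k, 0 <= s 0 k &
        A = U ^t* *m diag_mx s *m U].
Proof.
move=> psdA; have [U [s [UU UU' _ eA]]] := spectral_decomp (psd_adj psdA).
exists U, s; split => // k.
have := psd_diag_ge0 (psd_conj (U ^t*) psdA) k.
by rewrite trmxCK (conj_spectral UU eA) mxE eqxx mulr1n.
Qed.

Lemma psd_spectral n (U : 'M[C]_n) (s : 'rV[C]_n) :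
  (forall k, 0 <= s 0 k) -> psd (U ^t* *m diag_mx s *m U).
Proof.
move=> s_ge0; apply: psd_conj; split.
  by rewrite hermsymmxE adjmx_diag // => k; apply: ger0_real.
move=> v; rewrite mul_mx_diag mxE sumr_ge0 // => k _; rewrite !mxE.
by rewrite mulrAC mulr_ge0 // mulrC mul_conjC_ge0.
Qed.

Lemma mulmx_spectral n (U : 'M[C]_n) (s t : 'rV[C]_n) : U *m U ^t* = 1%:M ->
  (U ^t* *m diag_mx s *m U) *m (U ^t* *m diag_mx t *m U) =
  U ^t* *m diag_mx (\row_k (s 0 k * t 0 k)) *m U.
Proof.
move=> UU; rewrite !mulmxA -(mulmxA _ U) UU mulmx1 -(mulmxA _ (diag_mx s)).
congr (_ *m _ *m _); rewrite mulmx_diag; congr diag_mx.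
Qed.

Lemma psd_sqrt_exists {n} {A : 'M[C]_n} :
  psd A -> exists Y, psd Y /\ Y *m Y = A.
Proof.
move=> /psd_spectral_decomp[U [s [UU _ s_ge0 ->]]].
exists (U ^t* *m diag_mx (\row_k sqrtC (s 0 k)) *m U); split.
  by apply: psd_spectral => k; rewrite mxE sqrtC_ge0.
rewrite mulmx_spectral //; congr (_ *m diag_mx _ *m _).
by apply/rowP => k; rewrite !mxE -expr2 sqrtCK.
Qed.

(** With [A = S^2], cyclicity turns the trace into that of the congruence [S B S], which is again
    positive semidefinite. *)
Lemma psd_trmul_ge0 n (A B : 'M[C]_n) : psd A -> psd B -> 0 <= \tr (A *m B).
Proof.
move=> /psd_sqrt_exists[S [psdS <-]] psdB.
rewrite -mulmxA mxtrace_mulC -{1}(psd_adj psdS).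
exact/psd_tr_ge0/psd_conj.
Qed.

(* The diagonal entries of [Y - Z] and [Y + Z] in an eigenbasis of [Y - Z]:
   [Y^2 - Z^2] is half the anticommutator of the two matrices, and
   [|u* (Y - Z) u| <= u* (Y + Z) u]. *)
Lemma psd_diff_sqr n (Y Z U : 'M[C]_n) (s : 'rV[C]_n) :
  psd Y -> psd Z -> U *m U ^t* = 1%:M -> U ^t* *m U = 1%:M ->
  Y - Z = U ^t* *m diag_mx s *m U ->
  exists t : 'I_n -> C, forall k, `|s 0 k| <= t k /\
    (U *m (Y *m Y - Z *m Z) *m U ^t*) k k = s 0 k * t k.
Proof.
move=> psdY psdZ UU UU' eD.
exists (fun k => (U *m (Y + Z) *m U ^t*) k k) => k.
have y_ge0 := psd_diag_ge0 (psd_conj (U ^t*) psdY) k.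
have z_ge0 := psd_diag_ge0 (psd_conj (U ^t*) psdZ) k.
rewrite trmxCK in y_ge0 z_ge0.
have eDU := conj_spectral UU eD; split.
  have -> : s 0 k = (U *m (Y - Z) *m U ^t*) k k by rewrite eDU mxE eqxx.
  rewrite mulmxBr mulmxBl mulmxDr mulmxDl mxE [X in _ <= X]mxE [X in `|_ + X|]mxE.
  by rewrite (le_trans (ler_normB _ _)) // !ger0_norm.
pose T := U *m (Y + Z) *m U ^t*.
have -> : Y *m Y - Z *m Z = 2^-1 *: ((Y - Z) *m (Y + Z) + (Y + Z) *m (Y - Z)).
  rewrite !mulmxDr !mulmxDl !mulmxN !mulNmx.
  by apply/matrixP => i j; rewrite 8![in RHS]mxE !mxE; field.
have e : U *m ((Y - Z) *m (Y + Z) + (Y + Z) *m (Y - Z)) *m U ^t* =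
    diag_mx s *m T + T *m diag_mx s.
  rewrite -eDU /T mulmxDr mulmxDl !mulmxA.
  by rewrite -!(mulmxA _ (U ^t*) U) UU' !mulmx1.
rewrite -scalemxAr -scalemxAl e mul_diag_mx mul_mx_diag !mxE.
by field.
Qed.

(** By [psd_diff_sqr], each eigenvalue [s_k] of [Y - Z] satisfies [s_k t_k = 0] with [|s_k| <= t_k],
    hence vanishes. *)
Lemma psd_sqrt_inj n (Y Z : 'M[C]_n) :
  psd Y -> psd Z -> Y *m Y = Z *m Z -> Y = Z.
Proof.
move=> psdY psdZ eYZ.
have [|U [s [UU UU' _ eD]]] := spectral_decomp (A := Y - Z).
  by rewrite adjmxB (psd_adj psdY) (psd_adj psdZ).
have [t st] := psd_diff_sqr psdY psdZ UU UU' eD.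
suff s0 : s = 0.
  by apply/eqP; rewrite -subr_eq0 eD s0 linear0 mulmx0 mul0mx.
apply/rowP => k; rewrite mxE; have [le_st] := st k.
rewrite eYZ subrr mulmx0 mul0mx mxE => /esym/eqP; rewrite mulf_eq0.
case/orP=> /eqP // t0; apply/eqP; rewrite -normr_le0.
by rewrite -t0.
Qed.

End PositiveMatrices.

Definition is_test (C : numClosedFieldType) n (P : 'M[C]_n) : Prop :=
  psd P /\ psd (1%:M - P).

(** * Trace inequalities for tests, and the polar decomposition *)

Section Tests.
Context {C : numClosedFieldType}.

Lemma psd_idem n (E : 'M[C]_n) : E ^t* = E -> E *m E = E -> psd E.
Proof. by move=> hE EE; rewrite -EE -{1}hE; apply: psd_ctmul. Qed.

Lemma is_test_idem n (E : 'M[C]_n) : E ^t* = E -> E *m E = E -> is_test E.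
Proof.
move=> hE EE; split; apply: psd_idem => //; first by rewrite adjmxB adjmx1 hE.
by rewrite mulmxBr mulmx1 mulmxBl mul1mx EE subrr subr0.
Qed.

Lemma is_testC n (P : 'M[C]_n) : is_test P -> is_test (1%:M - P).
Proof. by move=> [psdP psdP']; split; rewrite // opprB addrC subrK. Qed.

Lemma is_test_spectral n (U : 'M[C]_n) (a : 'I_n -> bool) : U *m U ^t* = 1%:M ->
  is_test (U ^t* *m diag_mx (\row_k (a k)%:R) *m U).
Proof.
move=> UU; apply: is_test_idem.
  rewrite !adjmxM trmxCK adjmx_diag ?mulmxA // => k.
  by rewrite mxE realn.
rewrite mulmx_spectral //; congr (_ *m diag_mx _ *m _).
by apply/rowP => k; rewrite !mxE -natrM mulnb andbb.
Qed.

Lemma trace_conj n (U X : 'M[C]_n) : U ^t* *m U = 1%:M ->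
  \tr X = \sum_k (U *m X *m U ^t*) k k.
Proof. by move=> UU; rewrite -[RHS]/(\tr _) mxtrace_mulC mulmxA UU mul1mx. Qed.

Lemma trace_mul_spectral n (U P D : 'M[C]_n) (s : 'rV[C]_n) :
  D = U ^t* *m diag_mx s *m U ->
  \tr (P *m D) = \sum_k (U *m P *m U ^t*) k k * s 0 k.
Proof.
move=> ->; rewrite mulmxA mxtrace_mulC !mulmxA /mxtrace.
by apply: eq_bigr => k _; rewrite mul_mx_diag mxE.
Qed.

Lemma trace_test n (P A B : 'M[C]_n) :
  \tr (P *m A) + \tr ((1%:M - P) *m B) = \tr (P *m (A - B)) + \tr B.
Proof. by rewrite mulmxBl mul1mx mulmxBr !linearB /= -addrA [- _ + _]addrC. Qed.

Lemma trace_test_ge0 n (P A B : 'M[C]_n) : is_test P -> psd A -> psd B ->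
  0 <= \tr (P *m A) + \tr ((1%:M - P) *m B).
Proof. by move=> [psdP psdP'] psdA psdB; rewrite addr_ge0 ?psd_trmul_ge0. Qed.

(** By [trace_test] only [tr (P (A - B))] varies. In an eigenbasis of [A - B] it is a sum of
    eigenvalues weighted by the diagonal entries of [P], which lie in [0, 1]; weight 1 on the
    negative eigenvalues and 0 elsewhere is best. *)
Lemma optimal_test n (A B : 'M[C]_n) : A ^t* = A -> B ^t* = B ->
  exists P, is_test P /\ forall Q, is_test Q ->
    \tr (P *m A) + \tr ((1%:M - P) *m B) <=
    \tr (Q *m A) + \tr ((1%:M - Q) *m B).
Proof.
move=> hA hB.
have [|U [s [UU UU' s_real eD]]] := spectral_decomp (A := A - B).
  by rewrite adjmxB hA hB.
exists (U ^t* *m diag_mx (\row_k (s 0 k < 0)%R%:R) *m U); split.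
  exact: is_test_spectral.
move=> Q [psdQ psdQ']; rewrite !trace_test lerD2r !(trace_mul_spectral _ eD).
apply: ler_sum => k _; rewrite (conj_spectral UU erefl) !mxE eqxx mulr1n.
have q0 := psd_diag_ge0 (psd_conj (U ^t*) psdQ) k.
have := psd_diag_ge0 (psd_conj (U ^t*) psdQ') k.
rewrite mulmxBr mulmx1 mulmxBl !trmxCK UU mxE [1%:M _ _]mxE eqxx mulr1n.
rewrite trmxCK mxE in q0; rewrite [X in _ <= 1 + X]mxE mxE subr_ge0 => q1.
have /orP[s_ge0|s_le0] := real_leVge (real0 _) (s_real k).
  rewrite le_gtF // mul0r mulr_ge0 //.
have [s0|s0] := boolP (s 0 k < 0).
  by rewrite ler_nM2r.
have -> : s 0 k = 0 by move: s0; rewrite lt_neqAle s_le0 andbT negbK => /eqP.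
by rewrite !mulr0.
Qed.

(* Powers-Stormer: [tr |S^2 - T^2| >= tr (S - T)^2], with the test projecting
   onto the negative eigenspace of [S - T]. *)
Lemma sqrt_test n (A B S T : 'M[C]_n) : psd S -> psd T ->
  S *m S = A -> T *m T = B -> \tr A = 1 -> \tr B = 1 ->
  exists P, is_test P /\
    \tr (P *m A) + \tr ((1%:M - P) *m B) <= \tr (S *m T).
Proof.
move=> psdS psdT <- <- trS trT.
have [|U [s [UU UU' s_real eD]]] := spectral_decomp (A := S - T).
  by rewrite adjmxB (psd_adj psdS) (psd_adj psdT).
have [t st] := psd_diff_sqr psdS psdT UU UU' eD.
exists (U ^t* *m diag_mx (\row_k (s 0 k < 0)%R%:R) *m U); split.
  exact: is_test_spectral.
have sum_st : \sum_k s 0 k * t k = 0.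
  transitivity (\tr (S *m S - T *m T)); last by rewrite linearB /= trS trT subrr.
  by rewrite (trace_conj _ UU'); apply: eq_bigr => k _; rewrite (st k).2.
(* This is [tr (S - T)^2], expanded with both squares of trace 1. *)
have sum_ss : \sum_k s 0 k * s 0 k = 2 - 2 * \tr (S *m T).
  transitivity (\tr ((S - T) *m (S - T))).
    rewrite (trace_mul_spectral _ eD); apply: eq_bigr => k _.
    by rewrite (conj_spectral UU eD) mxE eqxx mulr1n.
  rewrite mulmxBl !mulmxBr !linearB /= trS trT (mxtrace_mulC T); ring.
rewrite trace_test trT.
(* Since [t k >= 0], keeping only the terms with [s 0 k < 0] amounts to taking negative parts,
   [(x - |x|) / 2] for [x = s 0 k * t k]. The sum of the [x] is zero, so only the absolute values
   remain, and [|s 0 k| <= t k] bounds them below by [sum_ss]. *)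
have -> : \tr (U ^t* *m diag_mx (\row_k (s 0 k < 0)%R%:R) *m U *m (S *m S - T *m T)) =
   \sum_k 2^-1 * (s 0 k * t k - `|s 0 k| * t k).
  rewrite mxtrace_mulC !mulmxA mxtrace_mulC !mulmxA.
  rewrite /mxtrace; apply: eq_bigr => k _.
  rewrite mul_mx_diag mxE (st k).2 mxE.
  have /orP[s_ge0|s_le0] := real_leVge (real0 _) (s_real k).
    by rewrite le_gtF // mulr0 ger0_norm // subrr mulr0.
  rewrite ler0_norm // mulNr opprK (_ : 2^-1 * _ = s 0 k * t k); last by field.
  have [s0|] := boolP (s 0 k < 0); first by rewrite mulr1.
  by rewrite lt_neqAle s_le0 andbT negbK => /eqP ->; rewrite !mul0r.
rewrite -mulr_sumr sumrB sum_st sub0r mulrN.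
have : \sum_k s 0 k * s 0 k <= \sum_k `|s 0 k| * t k.
  apply: ler_sum => k _; rewrite -expr2 -real_normK // expr2.
  by rewrite ler_wpM2l // (st k).1.
rewrite sum_ss => le_st.
have : 2^-1 * (2 - 2 * \tr (S *m T)) <= 2^-1 * \sum_k `|s 0 k| * t k.
  by rewrite ler_pM2l // invr_gt0 ltr0n.
rewrite mulrBr mulVf ?pnatr_eq0 // mulKf ?pnatr_eq0 // => le_st'.
by rewrite addrC lerBlDr -lerBlDl.
Qed.

(** In an eigenbasis of [Y], the squared norm of row [k] of [X] is [y_k^2], so the diagonal entry of
    [X] in that row has modulus at most [y_k]. *)
Lemma trace_le_sqrt n (X Y : 'M[C]_n) : psd Y -> Y *m Y = X *m X ^t* ->
  `|\tr X| <= \tr Y.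
Proof.
move=> /psd_spectral_decomp[U [y [UU UU' y_ge0 eY]]] eX.
rewrite (trace_conj X UU') (trace_conj Y UU') (conj_spectral UU eY).
rewrite (le_trans (ler_norm_sum _ _ _)) //; apply: ler_sum => k _.
rewrite [X in _ <= X]mxE eqxx mulr1n.
rewrite -(ler_pXn2r (n := 2)) ?nnegrE //.
have -> : y 0 k ^+ 2 = (U *m (Y *m Y) *m U ^t*) k k.
  by rewrite eY mulmx_spectral // (conj_spectral UU erefl) mxE eqxx mulr1n mxE.
have -> : U *m (Y *m Y) *m U ^t* = (U *m X *m U ^t*) *m (U *m X *m U ^t*) ^t*.
  rewrite eX [in RHS]adjmxM trmxCK [in RHS]adjmxM !mulmxA.
  by rewrite -(mulmxA (U *m X) (U ^t*) U) UU' mulmx1.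
rewrite [X in _ <= X]mxE (bigD1 k) //= !mxE normCK lerDl sumr_ge0 // => j _.
by rewrite !mxE mul_conjC_ge0.
Qed.

(** The Hilbert-Schmidt inner product is the standard one on the vectorized matrices. *)
Lemma trace_CauchySchwarz n (A B : 'M[C]_n) :
  `|\tr (A ^t* *m B)| <= sqrtC (\tr (A ^t* *m A)) * sqrtC (\tr (B ^t* *m B)).
Proof.
have dotE (X Y : 'M[C]_n) : dotmx (mxvec X) (mxvec Y) = \tr (Y ^t* *m X).
  rewrite dotmxE mxE (reindex _ (curry_mxvec_bij _ _)) /=.
  under [RHS]eq_bigr do rewrite mxE.
  rewrite exchange_big pair_bigA; apply: eq_bigr => [[i j] _] /=.
  by rewrite !mxE !mxvecE mulrC.
rewrite mulrC -!dotE.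
by have [le_dot _] := CauchySchwarz_sqrt (dotmx (n:=_)) (mxvec B) (mxvec A).
Qed.

Lemma trace_psd_CauchySchwarz n (M A B : 'M[C]_n) : psd M ->
  `|\tr (A ^t* *m M *m B)| <=
    sqrtC (\tr (A ^t* *m M *m A)) * sqrtC (\tr (B ^t* *m M *m B)).
Proof.
move=> /psd_sqrt_exists[S [psdS <-]].
have := trace_CauchySchwarz (S *m A) (S *m B).
by rewrite !adjmxM !(psd_adj psdS) !mulmxA.
Qed.

(** [G] is the Moore-Penrose inverse: nonzero eigenvalues are inverted, and the convention
    [0^-1 = 0] takes care of the kernel. *)
Lemma psd_pinv n (Y : 'M[C]_n) : psd Y -> exists G : 'M[C]_n,
  [/\ G ^t* = G, Y *m Y *m G = Y & G *m G *m (Y *m Y) *m (G *m G) = G *m G].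
Proof.
move=> /psd_spectral_decomp[U [y [UU _ y_ge0 ->]]].
exists (U ^t* *m diag_mx (\row_k (y 0 k)^-1) *m U); split.
- by apply: psd_adj; apply: psd_spectral => k; rewrite mxE invr_ge0.
- rewrite !mulmx_spectral //; congr (_ *m diag_mx _ *m _).
  apply/rowP => k; rewrite !mxE.
  by have [->|y0] := eqVneq (y 0 k) 0; rewrite ?mul0r // mulfK.
rewrite !mulmx_spectral //; congr (_ *m diag_mx _ *m _).
apply/rowP => k; rewrite !mxE.
have [->|y0] := eqVneq (y 0 k) 0; first by rewrite invr0 !mul0r.
by field.
Qed.

(* [W] is the adjoint of the partial isometry of the polar decomposition
   [X = Y W^*]. *)
Lemma polar_decomp n (X Y : 'M[C]_n) : psd Y -> Y *m Y = X *m X ^t* ->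
  exists W, X *m W = Y /\ psd (1%:M - W *m W ^t*).
Proof.
move=> /psd_pinv[G [hG YYG GYYG]] eX.
exists (X ^t* *m G); split; first by rewrite mulmxA -eX.
have -> : X ^t* *m G *m (X ^t* *m G) ^t* = X ^t* *m (G *m G) *m X.
  by rewrite adjmxM trmxCK hG !mulmxA.
(* [W W^*] is a projection: squaring it puts [X X^* = Y Y] between two copies of [G G], which [GYYG]
   absorbs. *)
have [_ //] : is_test (X ^t* *m (G *m G) *m X).
apply: is_test_idem; first by rewrite !adjmxM trmxCK hG !mulmxA.
by rewrite -[in RHS]GYYG eX !mulmxA.
Qed.

(** Cauchy-Schwarz weighted by [M], for [S] and [T W]. The contraction [W] then drops out: by
    cyclicity it enters only through [W W^*], which is at most 1, against the positive [T M T]. *)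
Lemma trace_sqrt_le n (S T M W : 'M[C]_n) : psd S -> psd T -> psd M ->
  psd (1%:M - W *m W ^t*) ->
  `|\tr (S *m M *m T *m W)| <=
    sqrtC (\tr (M *m (S *m S))) * sqrtC (\tr (M *m (T *m T))).
Proof.
move=> psdS psdT psdM psdW.
have := trace_psd_CauchySchwarz S (T *m W) psdM.
rewrite (psd_adj psdS) !mulmxA => /le_trans; apply.
have conj_ge0 X : psd X -> 0 <= \tr (X *m M *m X).
  by move=> psdX; rewrite -{1}(psd_adj psdX); exact/psd_tr_ge0/psd_conj.
have trE X : \tr (M *m X *m X) = \tr (X *m M *m X).
  by rewrite mxtrace_mulC mulmxA.
rewrite !trE ler_wpM2l ?sqrtC_ge0 ?conj_ge0 // ler_sqrtC ?nnegrE ?conj_ge0 //.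
  rewrite adjmxM (psd_adj psdT) -subr_ge0.
  suff <- : \tr ((1%:M - W *m W ^t*) *m (T *m M *m T)) =
      \tr (T *m M *m T) - \tr (W ^t* *m T *m M *m T *m W).
    by rewrite psd_trmul_ge0 // -{1}(psd_adj psdT); apply: psd_conj.
  rewrite mulmxBl mul1mx linearB /=; congr (_ - _).
  by rewrite -(mulmxA W) mxtrace_mulC !mulmxA.
by rewrite -[_ *m T *m W]mulmxA; apply/psd_tr_ge0/psd_conj.
Qed.

Lemma fidelity_test n (A B S T Y P : 'M[C]_n) : psd S -> psd T -> psd Y ->
  S *m S = A -> T *m T = B -> Y *m Y = S *m B *m S ->
  \tr A = 1 -> \tr B = 1 -> is_test P ->
  \tr Y ^+ 2 + (\tr (P *m A) - \tr (P *m B)) ^+ 2 <= 1.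
Proof.
move=> psdS psdT psdY <- <- eY trS trT [psdP psdP'].
have [|W [eW psdW]] := polar_decomp (X := S *m T) psdY.
  by rewrite adjmxM (psd_adj psdS) (psd_adj psdT) eY !mulmxA.
have tr' X : \tr X = 1 -> \tr ((1%:M - P) *m X) = 1 - \tr (P *m X).
  by move=> trX; rewrite mulmxBl mul1mx linearB /= trX.
have le1 := trace_sqrt_le psdS psdT psdP psdW.
have le2 := trace_sqrt_le psdS psdT psdP' psdW.
have tr_ge0 (X Z : 'M[C]_n) : psd X -> psd Z -> 0 <= \tr (X *m (Z *m Z)).
  by move=> psdX psdZ; rewrite psd_trmul_ge0 // -{1}(psd_adj psdZ); exact: psd_ctmul.
have : \tr Y = \tr (S *m P *m T *m W) + \tr (S *m (1%:M - P) *m T *m W).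
  by rewrite -linearD /= -!mulmxDl -mulmxDr addrC subrK mulmx1 eW.
have := tr_ge0 _ _ psdP psdS; have := tr_ge0 _ _ psdP psdT.
have := tr_ge0 _ _ psdP' psdS; have := tr_ge0 _ _ psdP' psdT.
have := psd_tr_ge0 psdY.
move: le1 le2; rewrite !tr' //.
move: (\tr Y) (\tr (P *m (S *m S))) (\tr (P *m (T *m T))) => f p q.
move: (\tr _) (\tr _) => x1 x2 le1 le2 f_ge0 q'_ge0 p'_ge0 q_ge0 p_ge0 ef.
(* Chosen so that [(u - v)^2] is exactly the slack left in the goal once [f] is replaced by its
   upper bound. *)
pose u := sqrtC p * sqrtC (1 - p); pose v := sqrtC q * sqrtC (1 - q).
have uv : 0 <= (u - v) ^+ 2.
  by rewrite -realEsqr realB // ger0_real // mulr_ge0 // sqrtC_ge0.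
have le_f : f ^+ 2 <= (sqrtC p * sqrtC q + sqrtC (1 - p) * sqrtC (1 - q)) ^+ 2.
  rewrite ler_pXn2r ?nnegrE // ?addr_ge0 ?mulr_ge0 ?sqrtC_ge0 //.
  by rewrite -(ger0_norm f_ge0) ef (le_trans (ler_normD _ _)) // lerD.
rewrite (le_trans (lerD le_f (lexx _))) // -subr_ge0.
suff <- : (u - v) ^+ 2 =
  1 - ((sqrtC p * sqrtC q + sqrtC (1 - p) * sqrtC (1 - q)) ^+ 2 + (p - q) ^+ 2).
  by [].
have := sqrtCK (1 - p); have := sqrtCK (1 - q).
rewrite /u /v; move: (sqrtC (1 - p)) (sqrtC (1 - q)) => a' b' eb' ea'.
have := sqrtCK p; have := sqrtCK q.
move: (sqrtC p) (sqrtC q) => a b eb ea.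
have {}ea' : a' ^+ 2 = 1 - a ^+ 2 by rewrite ea' ea.
have {}eb' : b' ^+ 2 = 1 - b ^+ 2 by rewrite eb' eb.
by rewrite -ea -eb sqrrB sqrrD !exprMn ea' eb'; ring.
Qed.

(* A state of rank one is a column times a row whose inner product is its
   trace, hence a projection. *)
Lemma rank1_idem n (A B : 'M[C]_n) : \rank A = 1%N -> \tr A = 1 ->
  A *m A = A /\ A *m B *m A = \tr (A *m B) *: A.
Proof.
move=> rA; have := mulmx_base A; move: (col_base A) (row_base A).
rewrite rA => c r eA; rewrite -eA mxtrace_mulC [r *m c]mx11_scalar => trA.
have rc : r *m c = 1%:M.
  by rewrite [r *m c]mx11_scalar; move: trA; rewrite mxtrace_scalar mulr1n => ->.
split; first by rewrite mulmxA -(mulmxA c) rc mulmx1.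
have -> : c *m r *m B *m (c *m r) = c *m (r *m B *m c) *m r by rewrite !mulmxA.
rewrite [r *m B *m c]mx11_scalar mul_mx_scalar -scalemxAl; congr (_ *: _).
by rewrite -[in RHS]mulmxA [RHS]mxtrace_mulC trace_mx11.
Qed.

End Tests.

(** * Kronecker powers *)

Section TensorPowers.
Import mxtens.
Context {C : numClosedFieldType}.

Lemma adjmx_tens m n p q (A : 'M[C]_(m, n)) (B : 'M[C]_(p, q)) :
  (tensmx A B) ^t* = tensmx (A ^t*) (B ^t*).
Proof. by apply/matrixP => i j; rewrite !mxE rmorphM. Qed.

Lemma psd_tens m n (A : 'M[C]_m) (B : 'M[C]_n) :
  psd A -> psd B -> psd (tensmx A B).
Proof.
move=> /psd_sqrt_exists[S [psdS <-]] /psd_sqrt_exists[T [psdT <-]].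
rewrite -tensmx_mul -{1}(psd_adj psdS) -{1}(psd_adj psdT) -adjmx_tens.
exact: psd_ctmul.
Qed.

Lemma trace_tens m n (A : 'M[C]_m) (B : 'M[C]_n) :
  \tr (tensmx A B) = \tr A * \tr B.
Proof. by rewrite /mxtrace mulr_sum; apply: eq_bigr => i _; rewrite mxE. Qed.

(** The exponent is [k.+1] because the induction starts from the first power, which is [A]
    itself. *)
Lemma psd_ntens n (A : 'M[C]_n) k : psd A -> psd (ntensmx A k.+1).
Proof. by move=> psdA; elim: k => // k IHk; apply: psd_tens. Qed.

Lemma ntens_mul n (A B : 'M[C]_n) k :
  ntensmx (A *m B) k.+1 = ntensmx A k.+1 *m ntensmx B k.+1.
Proof.
elim: k => // k IHk; rewrite [LHS]ntensmxSS IHk.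
exact: (esym (tensmx_mul _ _ _ _)).
Qed.

Lemma trace_ntens n (A : 'M[C]_n) k : \tr (ntensmx A k.+1) = \tr A ^+ k.+1.
Proof.
elim: k => [|k IHk]; first by rewrite expr1.
by rewrite exprS -IHk; apply: trace_tens.
Qed.

End TensorPowers.

(** * Fidelity and error probability as real numbers *)

Section Discrimination.
Context {R : realType}.
Local Notation C := R[i].

(** Uniqueness of the root identifies the choice made by [xget]; the witness [Y] excludes its
    default value. *)
Lemma sqrtmx_eq n (A Y : 'M[C]_n) : psdmx Y -> Y *m Y = A -> sqrtmx A = Y.
Proof.
move=> psdY eA; rewrite /sqrtmx.
case: xgetP => [Z _ [psdZ eZ]|/(_ Y)[]//].
by apply: (psd_sqrt_inj psdZ psdY); rewrite eZ eA.
Qed.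

Lemma sqrtmxP n (A : 'M[C]_n) : psdmx A ->
  psdmx (sqrtmx A) /\ sqrtmx A *m sqrtmx A = A.
Proof. by move=> /psd_sqrt_exists[Y [psdY eA]]; rewrite (sqrtmx_eq psdY eA). Qed.

Lemma psd_fidelity n (A B : 'M[C]_n) : psdmx A -> psdmx B ->
  psdmx (sqrtmx A *m B *m sqrtmx A).
Proof.
move=> /sqrtmxP[psdA _] psdB.
by have := psd_conj (sqrtmx A) psdB; rewrite (psd_adj psdA).
Qed.

Lemma ReK (z : C) : 0 <= z -> (complex.Re z)%:C = z.
Proof. by move=> z_ge0; rewrite RRe_real // ger0_real. Qed.

Lemma fidelityE n (A B : 'M[C]_n) : psdmx A -> psdmx B ->
  (fidelity A B)%:C = \tr (sqrtmx (sqrtmx A *m B *m sqrtmx A)).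
Proof.
move=> psdA psdB; apply: ReK; apply: psd_tr_ge0.
by have [] := sqrtmxP (psd_fidelity psdA psdB).
Qed.

Lemma fidelity_ge0 n (A B : 'M[C]_n) : psdmx A -> psdmx B -> 0 <= fidelity A B.
Proof.
move=> psdA psdB; rewrite -ler0c fidelityE //; apply: psd_tr_ge0.
by have [] := sqrtmxP (psd_fidelity psdA psdB).
Qed.

Lemma sqrtmx_ntens n (A : 'M[C]_n) k : psdmx A ->
  sqrtmx (mxtens.ntensmx A k.+1) = mxtens.ntensmx (sqrtmx A) k.+1.
Proof.
move=> /sqrtmxP[psdY eA]; apply: sqrtmx_eq; first exact: psd_ntens.
by rewrite -[LHS]ntens_mul eA.
Qed.

Lemma fidelity_ntens n (A B : 'M[C]_n) k : psdmx A -> psdmx B ->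
  fidelity (mxtens.ntensmx A k.+1) (mxtens.ntensmx B k.+1) =
  fidelity A B ^+ k.+1.
Proof.
move=> psdA psdB; apply: complexI; rewrite rmorphXn /=.
have psdAk : psdmx (mxtens.ntensmx A k.+1) := psd_ntens k psdA.
have psdBk : psdmx (mxtens.ntensmx B k.+1) := psd_ntens k psdB.
rewrite (fidelityE psdA psdB) (fidelityE psdAk psdBk) -trace_ntens.
rewrite -(sqrtmx_ntens k (psd_fidelity psdA psdB)) (sqrtmx_ntens k psdA).
congr (\tr (sqrtmx _)).
by rewrite [RHS]ntens_mul; congr (_ *m _); rewrite [RHS]ntens_mul.
Qed.

Lemma is_state_ntens n (A : 'M[C]_n) k :
  is_state A -> is_state (mxtens.ntensmx A k.+1).
Proof.
move=> [psdA trA]; split; first exact: psd_ntens.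
by rewrite trace_ntens trA expr1n.
Qed.

(** [P] is the operator for choosing [B], so the error probability on [A] is [tr (P A)]. *)
Definition test_error n (A B P : 'M[C]_n) : R :=
  2^-1 * complex.Re (\tr (P *m A) + \tr ((1%:M - P) *m B)).

(** Summing the operators of all outcomes on which the rule chooses the second state gives a test
    with the same error; conversely a test is a measurement with two outcomes. *)
Lemma joint_errorsP d (rho0 rho1 : 'M[C]_d) N e :
  joint_errors rho0 rho1 N e <->
  exists P, is_test P /\
    e = test_error (mxtens.ntensmx rho0 N) (mxtens.ntensmx rho1 N) P.
Proof.
set A := mxtens.ntensmx rho0 N; set B := mxtens.ntensmx rho1 N.
have ReD (x y : C) : complex.Re (x + y) = complex.Re x + complex.Re y.
  by case: x; case: y.
split=> [[I [M [rule [[psdM sumM] ->]]]]|[P [[psdP psdP'] ->]]].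
  have sumM' : 1%:M - \sum_(i | rule i) M i = \sum_(i | ~~ rule i) M i.
    by rewrite -sumM (bigID rule) /= addrAC subrr add0r.
  exists (\sum_(i | rule i) M i); split.
    by split; rewrite ?sumM'; apply: psd_sum.
  have outcomeE (Q : pred I) X :
      complex.Re (\tr ((\sum_(i | Q i) M i) *m X)) =
      \sum_(i | Q i) outcome_prob M X i.
    rewrite mulmx_suml.
    apply: (big_rec2 (fun Y y => complex.Re (\tr Y) = y)).
      by rewrite mxtrace0.
    by move=> i y Y _ <-; rewrite mxtraceD ReD.
  by rewrite /test_error sumM' ReD mulrDr !outcomeE.
exists bool, (fun b => if b then P else 1%:M - P), id; split.
  split; first (case; [exact: psdP|exact: psdP']).
  by rewrite big_bool /= addrC subrK.
rewrite /test_error /average_error /outcome_prob ReD mulrDr.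
by congr (_ * _ + _ * _); rewrite big_mkcond big_bool /= ?addr0 ?add0r.
Qed.

(** [optimal_test] shows that the minimum is attained, so [min_error] is not the default value of
    [xget]. *)
Lemma min_errorP d (rho0 rho1 : 'M[C]_d) k :
  is_state rho0 -> is_state rho1 ->
  let A := mxtens.ntensmx rho0 k.+1 in let B := mxtens.ntensmx rho1 k.+1 in
  (exists P, is_test P /\ min_error rho0 rho1 k.+1 = test_error A B P) /\
  forall P, is_test P -> min_error rho0 rho1 k.+1 <= test_error A B P.
Proof.
move=> /(is_state_ntens k)[psdA _] /(is_state_ntens k)[psdB _] A B.
have [P [testP minP]] := optimal_test (psd_adj psdA) (psd_adj psdB).
have minE : joint_errors rho0 rho1 k.+1 (test_error A B P) /\
    lbound (joint_errors rho0 rho1 k.+1) (test_error A B P).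
  split; first by apply/joint_errorsP; exists P.
  move=> _ /joint_errorsP[Q [testQ ->]].
  rewrite /test_error ler_pM2l ?invr_gt0 //.
  by have := minP _ testQ; rewrite lecE => /andP[].
rewrite /min_error; case: xgetP => [e _ [err_e lb_e]|/(_ _ minE)//].
split; first exact/joint_errorsP.
by move=> Q testQ; apply: lb_e; apply/joint_errorsP; exists Q.
Qed.

(** Since [tr B = 1], the term [1 - 2 * test_error A B P] is [tr (P B) - tr (P A)]; this is
    [fidelity_test] read in the reals. *)
Lemma test_error_ge n (A B P : 'M[C]_n) : is_state A -> is_state B ->
  is_test P ->
  fidelity A B ^+ 2 + (1 - 2 * test_error A B P) ^+ 2 <= 1.
Proof.
move=> stA stB testP; have [psdA trA] := stA; have [psdB trB] := stB.
have [psdS eS] := sqrtmxP psdA; have [psdT eT] := sqrtmxP psdB.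
have [psdY eY] := sqrtmxP (psd_fidelity psdA psdB).
have := fidelity_test psdS psdT psdY eS eT eY trA trB testP.
have [psdP _] := testP.
rewrite -(fidelityE psdA psdB) /test_error.
rewrite mulmxBl mul1mx linearB /= trB.
have := psd_trmul_ge0 psdP psdA; have := psd_trmul_ge0 psdP psdB.
move=> /ReK <- /ReK <-.
move: (complex.Re _) (complex.Re _) => p q.
rewrite -(rmorph1 (real_complex R)) -!(rmorphB, rmorphD, rmorphXn) /= lecR => le1.
rewrite (_ : 1 - _ = - (q - p)) ?sqrrN //.
by field.
Qed.

Lemma exists_test_le_fidelity n (A B : 'M[C]_n) : is_state A -> is_state B ->
  exists P, is_test P /\ test_error A B P <= 2^-1 * fidelity A B.
Proof.
move=> stA stB; have [psdA trA] := stA; have [psdB trB] := stB.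
have [psdS eS] := sqrtmxP psdA; have [psdT eT] := sqrtmxP psdB.
have [psdY eY] := sqrtmxP (psd_fidelity psdA psdB).
have [P [testP leP]] := sqrt_test psdS psdT eS eT trA trB.
exists P; split=> //; rewrite /test_error ler_pM2l ?invr_gt0 //.
rewrite -lecR fidelityE //.
rewrite (ReK (trace_test_ge0 testP psdA psdB)).
apply: le_trans leP _.
rewrite -[X in X <= _](ger0_norm (psd_trmul_ge0 psdS psdT)).
apply: (trace_le_sqrt psdY); rewrite adjmxM (psd_adj psdS) (psd_adj psdT) eY.
by rewrite -[in LHS]eT !mulmxA.
Qed.

(** The projection [A] is its own square root, so the matrix under the outer root is [tr (A B) A],
    with root [sqrt (tr (A B)) A]. *)
Lemma pure_fidelity n (A B : 'M[C]_n) : is_pure A -> is_state B ->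
  (fidelity A B ^+ 2)%:C = \tr (A *m B).
Proof.
move=> [[psdA trA] rA] [psdB trB].
have [AA ABA] := rank1_idem B rA trA.
have tr_ge0 := psd_trmul_ge0 psdA psdB.
rewrite rmorphXn /= fidelityE // (sqrtmx_eq psdA AA) ABA.
rewrite (sqrtmx_eq (Y := sqrtC (\tr (A *m B)) *: A)).
- by rewrite linearZ /= trA mulr1 sqrtCK.
- by apply: (psdZ _ psdA); rewrite sqrtC_ge0.
by rewrite -scalemxAl -scalemxAr scalerA -expr2 sqrtCK AA.
Qed.

End Discrimination.

(** * From bounds for each [N] to asymptotic exponents *)

Section Exponents.
Import numFieldNormedType.Exports.
Context {R : realType}.

Lemma limn_esup_le (u : nat -> \bar R) l : (forall n, (0 < n)%N -> (u n <= l)%E) ->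
  (limn_esup u <= l)%E.
Proof.
move=> le_ul; rewrite limn_esup_lim; apply: lime_le; first exact: is_cvg_esups.
near=> n; apply: ge_ereal_sup => _ [m /= le_nm <-]; apply: le_ul.
by apply: leq_trans le_nm; near: n; exists 1%N.
Unshelve. all: by end_near. Qed.

Lemma limn_einf_le (u v : nat -> \bar R) : (forall n, (0 < n)%N -> (u n <= v n)%E) ->
  (limn_einf u <= limn_einf v)%E.
Proof.
move=> le_uv; rewrite !limn_einf_lim.
apply: lee_lim; [exact: is_cvg_einfs|exact: is_cvg_einfs|].
near=> n; apply: le_ereal_inf_tmp => _ [m /= le_nm <-].
have m_gt0 : (0 < m)%N by apply: leq_trans le_nm; near: n; exists 1%N.
by apply: le_trans (le_uv _ m_gt0); apply: ereal_inf_lbound; exists m.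
Unshelve. all: by end_near. Qed.

Lemma limn_esup_exponent (e : nat -> R) (F : R) : 0 <= F ->
  (forall n, (0 < n)%N -> e n <= 2^-1 * F ^+ n) ->
  (limn_esup (fun n => (n%:R^-1)%:E * lne (e n)%:E) <= lne F%:E)%E.
Proof.
move=> F_ge0 le_e; apply: limn_esup_le => n n_gt0.
have n_gt0' : (0 < (n%:R : R)^-1%:E)%E by rewrite lte_fin invr_gt0 ltr0n.
(* For [e n <= 0] the logarithm is minus infinity and the bound is trivial. *)
have [en_le0|en_gt0] := leP (e n) 0.
  by rewrite le0_lneNy ?lee_fin // gt0_muleNy // leNye.
have Fn_gt0 : 0 < F ^+ n.
  by have := lt_le_trans en_gt0 (le_e n n_gt0); rewrite pmulr_rgt0 // invr_gt0.
have F_gt0 : 0 < F by move: Fn_gt0; rewrite !lt0r exprn_ge0 // expf_eq0 n_gt0 F_ge0.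
rewrite !lne_EFin // -EFinM lee_fin mulrC ler_pdivrMr ?ltr0n //.
rewrite mulr_natr -lnXn // ler_ln ?posrE //.
apply: le_trans (le_e n n_gt0) _; rewrite ler_piMl ?exprn_ge0 //; lra.
Qed.

(** The constant [c] contributes only [ln c / n], which tends to 0; for [F = 0] the left-hand side
    is minus infinity. *)
Lemma limn_einf_exponent (e : nat -> R) (F c : R) : 0 <= F -> 0 < c ->
  (forall n, (0 < n)%N -> c * F ^+ (2 * n) <= e n) ->
  (2%:E * lne F%:E <= limn_einf (fun n => (n%:R^-1)%:E * lne (e n)%:E))%E.
Proof.
move=> F_ge0 c_gt0 ge_e; have [->|F_neq0] := eqVneq F 0.
  by rewrite le0_lneNy // gt0_muleNy ?leNye // lte_fin.
have F_gt0 : 0 < F by rewrite lt0r F_neq0.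
pose v n : \bar R := (2 * ln F + n%:R^-1 * ln c)%:E.
have cvg_v : (v @ \oo --> (2 * ln F)%:E)%classic.
  apply: cvg_EFin; first by near=> n.
  rewrite -[X in (_ --> X)%classic]addr0 -[X in _ + X](mul0r (ln c)).
  apply: cvgD; first exact: cvg_cst.
  (* The harmonic sequence is indexed as [1 / (n + 1)], hence the shift. *)
  apply: cvgMr_tmp; rewrite -(cvg_shiftS (fun n : nat => (n%:R : R)^-1)).
  exact: cvg_harmonic.
rewrite (lne_EFin F_gt0) -EFinM -(cvg_limn_einf_sup cvg_v).1.
apply: limn_einf_le => n n_gt0.
have lb_gt0 : 0 < c * F ^+ (2 * n) by rewrite mulr_gt0 ?exprn_gt0.
have en_gt0 := lt_le_trans lb_gt0 (ge_e n n_gt0).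
have n0 : n%:R != 0 :> R by rewrite pnatr_eq0 -lt0n.
rewrite lne_EFin // -EFinM lee_fin.
have -> : 2 * ln F + n%:R^-1 * ln c = n%:R^-1 * ln (c * F ^+ (2 * n)).
  rewrite lnM ?posrE ?exprn_gt0 // lnXn // -[ln F *+ _]mulr_natr natrM.
  by field.
by rewrite ler_pM2l ?invr_gt0 ?ltr0n // ler_ln ?posrE // ge_e.
Unshelve. all: by end_near. Qed.

(** Linearizes the lower bound on the error for the asymptotics: [1 - y <= (1 - y / 2)^2]. *)
Lemma sqrt1B_le (y : R) : 0 <= y <= 1 -> 4^-1 * y <= 2^-1 * (1 - Num.sqrt (1 - y)).
Proof.
move=> /andP[y_ge0 y_le1].
suff : Num.sqrt (1 - y) <= 1 - y / 2 by lra.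
rewrite -[leRHS]ger0_norm; last by lra.
by rewrite -sqrtr_sqr ler_sqrt ?sqr_ge0 //; nra.
Qed.

End Exponents.

(** * Bounds on the minimal error for [N] copies *)

Section Bounds.
Context {R : realType} {d : nat} {rho0 rho1 : 'M[R[i]]_d}.
Context (st0 : is_state rho0) (st1 : is_state rho1).
Local Notation F := (fidelity rho0 rho1).
Local Notation e := (min_error rho0 rho1).

Lemma min_error_fidelity_circle k :
  F ^+ (2 * k.+1) + (1 - 2 * e k.+1) ^+ 2 <= 1.
Proof.
have [[P [testP ->]] _] := min_errorP k st0 st1.
rewrite mulnC exprM -(fidelity_ntens k st0.1 st1.1).
exact: (test_error_ge (is_state_ntens k st0) (is_state_ntens k st1)).
Qed.

Lemma min_error_le k : e k.+1 <= 2^-1 * F ^+ k.+1.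
Proof.
have [_ le_e] := min_errorP k st0 st1.
rewrite -(fidelity_ntens k st0.1 st1.1).
have [P [testP]] :=
  exists_test_le_fidelity (is_state_ntens k st0) (is_state_ntens k st1).
exact: le_trans (le_e P testP).
Qed.

Lemma fidelity_state_ge0 : 0 <= F.
Proof. exact: (fidelity_ge0 st0.1 st1.1). Qed.

(** The circle inequality for a single copy already gives [F^2 <= 1]. *)
Lemma fidelity_expr_le1 n : F ^+ n <= 1.
Proof.
rewrite exprn_ile1 ?fidelity_state_ge0 //.
have := min_error_fidelity_circle 0; have := fidelity_state_ge0.
rewrite muln1 => F_ge0 le1; rewrite -(ler_pXn2r (n := 2)) ?nnegrE // expr1n.
by apply: le_trans le1; rewrite lerDl sqr_ge0.
Qed.

Lemma min_error_ge k :
  2^-1 * (1 - Num.sqrt (1 - F ^+ (2 * k.+1))) <= e k.+1.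
Proof.
have := min_error_fidelity_circle k.
move: (e _) (F ^+ _) => x y le1.
suff : 1 - 2 * x <= Num.sqrt (1 - y) by lra.
apply: le_trans (ler_norm _) _; rewrite -sqrtr_sqr.
have := sqr_ge0 (1 - 2 * x); move: le1; move: (_ ^+ 2) => z le1 z_ge0.
by rewrite ler_sqrt; lra.
Qed.

(** Choosing the first state exactly on the projection given by its own power makes no error on that
    state; the error on the other one is [tr (rho0 rho1)] to the number of copies. *)
Lemma pure_min_error_le k : is_pure rho0 -> e k.+1 <= 2^-1 * F ^+ (2 * k.+1).
Proof.
move=> pure0; have [[psd0 tr0] rk0] := pure0.
have [AA _] := rank1_idem rho1 rk0 tr0.
have [_ le_e] := min_errorP k st0 st1.
have psdN := psd_ntens k psd0.
have NN : mxtens.ntensmx rho0 k.+1 *m mxtens.ntensmx rho0 k.+1 =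
    mxtens.ntensmx rho0 k.+1 by rewrite -[LHS]ntens_mul AA.
have testN := is_testC (is_test_idem (psd_adj psdN) NN).
apply: le_trans (le_e _ testN) _; rewrite /test_error ler_pM2l ?invr_gt0 //.
rewrite mulmxBl mul1mx NN subrr mxtrace0 add0r.
rewrite opprB addrC subrK -[_ *m _]ntens_mul trace_ntens.
by rewrite -(pure_fidelity pure0 st1) -rmorphXn /= exprM.
Qed.

End Bounds.

Theorem theorem4p4 (R : realType) (d : nat) (rho0 rho1 : 'M[R[i]]_d)
    (hrho0 : is_state rho0) (hrho1 : is_state rho1) :
  (forall N : nat, (0 < N)%N ->
     2^-1 * (1 - Num.sqrt (1 - fidelity rho0 rho1 ^+ (2 * N)))
       <= min_error rho0 rho1 N
       <= 2^-1 * fidelity rho0 rho1 ^+ N) /\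
  (2%:E * lne (fidelity rho0 rho1)%:E
     <= limn_einf (fun N : nat => (N%:R^-1)%:E * lne (min_error rho0 rho1 N)%:E))%E /\
  (limn_esup (fun N : nat => (N%:R^-1)%:E * lne (min_error rho0 rho1 N)%:E)
     <= lne (fidelity rho0 rho1)%:E)%E /\
  (is_pure rho0 ->
     (forall N : nat, (0 < N)%N ->
        min_error rho0 rho1 N <= 2^-1 * fidelity rho0 rho1 ^+ (2 * N)) /\
     (forall psi0 : 'cV[R[i]]_d,
        psi0 ^t* *m psi0 = 1%:M -> rho0 = psi0 *m psi0 ^t* ->
        forall N : nat, (0 < N)%N ->
          (2^-1 * fidelity rho0 rho1 ^+ (2 * N))%:C
          = 2^-1 * ((psi0 ^t* *m rho1 *m psi0) 0 0) ^+ N)).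
Proof.
have F_ge0 := fidelity_state_ge0 hrho0 hrho1.
split; last split; last split.
- by move=> [//|k] _; rewrite min_error_ge ?min_error_le.
(* The constant 1/4 is the one of [sqrt1B_le] at [y = F^(2N)]. *)
- apply: (limn_einf_exponent (c := 4^-1)) => // -[//|k] _.
  apply: le_trans (min_error_ge hrho0 hrho1 k); apply: sqrt1B_le.
  by rewrite exprn_ge0 // fidelity_expr_le1.
- by apply: limn_esup_exponent => // -[//|k] _; apply: min_error_le.
move=> pure0; split=> [[//|k] _|psi0 _ epsi0 N _]; first exact: pure_min_error_le.
rewrite rmorphM rmorphV ?unitfE ?pnatr_eq0 //= rmorph_nat; congr (_ * _).
rewrite exprM rmorphXn /= pure_fidelity // epsi0; congr (_ ^+ _).
by rewrite -mulmxA mxtrace_mulC trace_mx11.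
Qed.
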